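(* Let $f_1,f_2\in\mathbb{Q}/\mathbb{Z}$ and $g_1,g_2\in\mathbb{Q}$. Then $$\langle\mathbf{w}(f_1,g_1),\mathbf{w}(f_2,g_2)\rangle=e^{2\pi i(g_1-g_2)}\,\delta_{f_1,f_2},$$ where $\delta_{f_1,f_2}$ is the Kronecker delta on $\mathbb{Q}/\mathbb{Z}$. In particular, the set $$\mathcal{B}_{\mathrm{wave}}=\{\mathbf{w}(f,0)\mid f\in\mathbb{Q}/\mathbb{Z}\}$$ is an orthonormal system in $(\mathcal{V},\langle\cdot,\cdot\rangle)$.
   Context: For $f\in\mathbb{Q}/\mathbb{Z}$ and $g\in\mathbb{Q}$, $\mathbf{w}(f,g):\mathbb{Z}\to\mathbb{C}$ is the sequence $\mathbf{w}(f,g)[m]=\exp(2\pi i(fm+g))$ (well defined since $m\in\mathbb{Z}$). $\mathcal{V}=\operatorname{span}_{\mathbb{C}}\{\mathbf{w}(f,g)\mid f\in\mathbb{Q}/\mathbb{Z},\,g\in\mathbb{Q}\}$; every element of $\mathcal{V}$ is periodic. For $u,v\in\mathcal{V}$ with fundamental periods $n_u,n_v$, the principal period inner product is $$\langle u,v\rangle=\frac1L\sum_{m=1}^L u[m]\overline{v[m]},\qquad L=\operatorname{lcm}(n_u,n_v).$$ *)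

(* Defs.v *)
From HB Require Import structures.
From mathcomp Require Import all_boot all_order all_algebra.
From mathcomp Require Import generic_quotient ring_quotient.
From mathcomp Require Import all_classical all_reals all_analysis.
From mathcomp Require Import complex ring.

Set Implicit Arguments.
Unset Strict Implicit.
Unset Printing Implicit Defensive.

Import Order.TTheory GRing.Theory Num.Theory.

Local Open Scope classical_set_scope.
Local Open Scope complex_scope.
Local Open Scope ring_scope.

Definition rat_integers : {pred rat} := fun x => x \is a Num.int.

Fact rat_integers_zmod_closed : zmod_closed rat_integers.
Proof. by split=> [|x y]; [exact: rpred0 | exact: rpredB]. Qed.

HB.instance Definition _ :=
  GRing.isZmodClosed.Build rat rat_integers rat_integers_zmod_closed.

Definition QmodZ := Quotient.quot (GRing.ZmodClosed.clone rat rat_integers _).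

Lemma eq_QmodZ (x y : rat) :
  (\pi_(QmodZ)%qT x == \pi_(QmodZ)%qT y) = (x - y \is a Num.int).
Proof. by rewrite -Quotient.idealrBE. Qed.

Section Waves.
Variable R : realType.
Local Notation C := R[i].

(* e^(a + ib) = e^a (cos b + i sin b) *)
Definition cexp (z : C) : C :=
  (expR (complex.Re z))%:C * (cos (complex.Im z) +i* sin (complex.Im z)).

Lemma cexpD (z1 z2 : C) : cexp (z1 + z2) = cexp z1 * cexp z2.
Proof.
case: z1 z2 => [a b] [c d]; rewrite /cexp /= expRD cosD sinD; simpc.
by congr (_ +i* _); ring.
Qed.

Lemma cexp0 : cexp 0 = 1.
Proof. by rewrite /cexp /= expR0 cos0 sin0; simpc. Qed.

Lemma cexp_2pi_int (n : int) : cexp (2 * pi%:C * 'i%C * n%:~R) = 1.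
Proof.
have cexp_nat (k : nat) : cexp (2 * pi%:C * 'i%C * k%:R) = 1.
  elim: k => [|k IHk]; first by rewrite mulr0 cexp0.
  rewrite -[k.+1%:R]natr1 mulrDr cexpD IHk mul1r mulr1.
  have -> : 2 * pi%:C * 'i%C = 0 +i* (pi *+ 2) :> C.
    by rewrite mulr_natl -rmorphMn /=; simpc.
  by rewrite /cexp /= expR0 cos2pi sin2pi; simpc.
case: (intP n) => [|k|k]; first by rewrite mulr0 cexp0.
  by rewrite cexp_nat.
have := cexpD (2 * pi%:C * 'i%C * k.+1%:R) (2 * pi%:C * 'i%C * (- k.+1%:Z)%:~R).
by rewrite cexp_nat mul1r -mulrDr mulrNz -pmulrn subrr mulr0 cexp0 => <-.
Qed.

Lemma cexp_2pi_addz (x : rat) (n : int) :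
  cexp (2 * pi%:C * 'i%C * ratr (x + n%:~R)) = cexp (2 * pi%:C * 'i%C * ratr x).
Proof.
have -> : ratr (x + n%:~R) = ratr x + n%:~R :> C by rewrite rmorphD /= ratr_int.
by rewrite [X in cexp X]mulrDr cexpD cexp_2pi_int mulr1.
Qed.

Definition wave (f : QmodZ) (g : rat) : int -> C :=
  fun m => cexp (2 * pi%:C * 'i%C * ratr (repr f * m%:~R + g)).

(* [wave] evaluates at the representative [repr f]; the value does not
   depend on the choice of representative. *)
Lemma wave_pi (x g : rat) (m : int) :
  wave (\pi_(QmodZ)%qT x) g m = cexp (2 * pi%:C * 'i%C * ratr (x * m%:~R + g)).
Proof.
have : repr (\pi_(QmodZ)%qT x) - x \is a Num.int.
  by rewrite -eq_QmodZ reprK.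
case/intrP => k /(canRL (subrK _)) reprE; rewrite /wave reprE.
have -> : (k%:~R + x) * m%:~R + g = x * m%:~R + g + (k * m)%:~R.
  by rewrite intrM; ring.
exact: cexp_2pi_addz.
Qed.

Definition lin_span (S : set (int -> C)) : set (int -> C) :=
  [set u | exists (n : nat) (c : 'I_n -> C) (v : 'I_n -> int -> C),
     (forall j, S (v j)) /\ u = \sum_(j < n) c j *: v j].

Definition wave_space : set (int -> C) :=
  lin_span [set u | exists f g, u = wave f g].

Definition is_fundamental_period (u : int -> C) (n : nat) : Prop :=
  [/\ (0 < n)%N, periodic u n%:Z &
      forall k : nat, (0 < k)%N -> periodic u k%:Z -> (n <= k)%N].

(* Junk value 0 on sequences that are not periodic; members of [wave_space]
   are periodic, so there it is the least positive period. *)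
Definition fundamental_period (u : int -> C) : nat :=
  xget 0%N [set n | is_fundamental_period u n].

Lemma wave_space_periodic (u : int -> C) :
  wave_space u -> exists2 n : nat, (0 < n)%N & periodic u n%:Z.
Proof.
case=> n [c [v [vS ->]]].
apply: (big_ind (fun w : int -> C =>
  exists2 p : nat, (0 < p)%N & periodic w p%:Z)) => [|w1 w2|j _].
- by exists 1%N.
- case=> [p p_gt0 w1p] [q q_gt0 w2q]; exists (p * q)%N.
    by rewrite muln_gt0 p_gt0.
  move=> m; congr (_ + _).
    by rewrite PoszM -[q%:Z]natz mulr_natr periodicn.
  by rewrite PoszM -[p%:Z]natz mulr_natl periodicn.
- have [f [g ->]] := vS j; exists `|denq (repr f)|%N.
    by rewrite absz_gt0 denq_neq0.
  move=> m; congr (_ *: _); rewrite /wave.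
  rewrite gez0_abs ?denq_ge0 // intrD mulrDr -numqE addrAC.
  exact: cexp_2pi_addz.
Qed.

Lemma fundamental_periodP (u : int -> C) :
  wave_space u -> is_fundamental_period u (fundamental_period u).
Proof.
move=> /wave_space_periodic [p p_gt0 up]; apply: xgetPex.
pose P := [pred k : nat | (0 < k)%N && `[< periodic u k%:Z >]].
have exP : exists k, P k by exists p; rewrite /= p_gt0; apply/asboolP.
case: (ex_minnP exP) => n /andP[n_gt0 /asboolP un] n_min.
exists n; split=> // k k_gt0 uk; apply: n_min.
by rewrite /= k_gt0; apply/asboolP.
Qed.

Definition period_inner (u v : int -> C) : C :=
  let L := lcmn (fundamental_period u) (fundamental_period v) in
  L%:R^-1 * \sum_(1 <= m < L.+1) u m%:Z * ((v m%:Z)^*)%C.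

(* [ip] is only evaluated on members of [B], hence of [V]. *)
Definition orthonormal_system
    (V : set (int -> C)) (ip : (int -> C) -> (int -> C) -> C)
    (B : set (int -> C)) : Prop :=
  [/\ B `<=` V,
      forall u, B u -> ip u u = 1 &
      forall u v, B u -> B v -> u <> v -> ip u v = 0].

Definition wave_basis : set (int -> C) := [set wave f 0 | f in [set: QmodZ]].

End Waves.

Arguments wave_space R : clear implicits.
Arguments wave_basis R : clear implicits.

(* Main.v *)
Require Import Defs.
From mathcomp Require Import all_boot all_order all_algebra.
From mathcomp Require Import generic_quotient.
From mathcomp Require Import all_classical all_reals all_analysis.
From mathcomp Require Import complex ring lra.

Import GRing.Theory Num.Theory.
Local Open Scope complex_scope.
Local Open Scope ring_scope.

(** Write e(x) for exp (2 pi i x). Since e is a homomorphism from the additive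
    rationals to the unit circle, conjugation inverts it, and the m-th term of
    the inner product of w(f1, g1) and w(f2, g2) is e(x m + g) with
    x = f1 - f2 and g = g1 - g2 (lemma [wave_mul_conj]).  If f1 = f2 in Q/Z,
    all the terms equal e(g) and so does their mean.

    Otherwise the terms form a geometric progression of ratio e(x), and
    e(x) <> 1 because the kernel of e is exactly Z ([phase_eq1]).  The number L
    of terms is a common multiple of the periods of both waves, hence a period
    of the progression.  Multiplication by the ratio shifts the summation
    window by one step, which leaves a sum over a full period unchanged; a sum
    fixed under multiplication by a scalar other than 1 vanishes
    ([sum_periodic_geometric]).  Orthonormality of the waves with g = 0 is then
    immediate, since distinct waves have distinct frequencies. *)

Section Orthogonality.
Variable R : realType.
Local Notation C := R[i].

Definition phase (x : rat) : C := cexp (2 * pi%:C * 'i%C * ratr x).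

Lemma phaseE (x : rat) :
  phase x = cos (2 * pi * ratr x) +i* sin (2 * pi * ratr x) :> C.
Proof.
have -> : phase x = cexp (0 +i* (2 * pi * ratr x) : C).
  rewrite /phase; congr cexp.
  have -> : ratr x = (ratr x : R)%:C :> C by rewrite fmorph_rat.
  have -> : 2 = (2 : R)%:C :> C by rewrite rmorph_nat.
  by simpc.
by rewrite /cexp /= expR0 mul1r.
Qed.

Lemma phase0 : phase 0 = 1.
Proof. by rewrite /phase (rmorph0 (@ratr C)) mulr0 cexp0. Qed.

Lemma phaseD (x y : rat) : phase (x + y) = phase x * phase y.
Proof. by rewrite /phase (rmorphD (@ratr C)) [X in cexp X]mulrDr cexpD. Qed.

Lemma phase_conj (x : rat) : ((phase x)^*)%C = phase (- x).
Proof. by rewrite !phaseE /= rmorphN /= mulrN cosN sinN. Qed.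

Lemma phase_int (n : int) : phase n%:~R = 1.
Proof. by rewrite /phase ratr_int cexp_2pi_int. Qed.

(** After removing the integer part, x lies in [0, 1[, and
    cos (2 pi x) = 1 - 2 sin (pi x) ^ 2 with sin positive on ]0, pi[. *)
Lemma phase_eq1 (x : rat) : phase x = 1 -> x \is a Num.int.
Proof.
move=> x1; set y := x - (Num.floor x)%:~R.
have y1 : phase y = 1 by rewrite /y -mulrNz phaseD x1 phase_int mulr1.
have y_ge0 : 0 <= y by rewrite subr_ge0 Num.Theory.floor_le.
have y_lt1 : y < 1.
  by rewrite ltrBlDr addrC -[1]/(1%:~R) -intrD Num.Theory.floorD1_gt.
have [y0|y_neq0] := eqVneq y 0.
  by rewrite -[x](subrK (Num.floor x)%:~R) -/y y0 add0r intr_int.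
have y_gt0 : (0 : R) < ratr y by rewrite ltr0q lt0r y_neq0.
have sin_gt0 : 0 < sin (pi * ratr y : R).
  apply: sin_gt0_pi; rewrite mulr_gt0 ?pi_gt0 //=.
  by rewrite gtr_pMr ?pi_gt0 // -(rmorph1 (@ratr R)) ltr_rat.
have : cos (2 * pi * ratr y : R) = 1.
  by have := congr1 (@complex.Re R) y1; rewrite phaseE.
have -> : 2 * pi * ratr y = (pi * ratr y) *+ 2 :> R by ring.
rewrite cos_mulr2n; have := cos2Dsin2 (pi * ratr y : R); nra.
Qed.

(** Shifting the window by one step multiplies the sum by z, but only exchanges
    the end terms t 1 and t (L + 1), which agree. *)
Lemma sum_periodic_geometric (z : C) (t : int -> C) (L : nat) :
  z != 1 -> periodic t L%:Z -> (forall m, t (m + 1) = z * t m) ->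
  \sum_(1 <= m < L.+1) t m%:Z = 0.
Proof.
move=> z_neq1 tL tS.
set S := \sum_(_ <= _ < _) _.
suff zS : z * S = S.
  apply/eqP; move/eqP: zS; rewrite -subr_eq0 -{2}[S]mul1r -mulrBl mulf_eq0.
  by rewrite subr_eq0 (negbTE z_neq1).
have shift : \sum_(1 <= m < L.+1) t m.+1%:Z = S.
  (* both sides complete to the sum over the window 1, ..., L + 1 *)
  apply: (addrI (t 1)).
  rewrite -(big_add1 _ _ 1%N L.+2 xpredT (fun m : nat => t m%:Z)).
  rewrite -big_ltn // big_nat_recr //= addrC; congr (_ + _).
  by rewrite -addn1 PoszD addrC tL.
by rewrite -{2}shift mulr_sumr; apply: eq_bigr => m _; rewrite -tS -PoszD addn1.
Qed.

Lemma wave_mul_conj (f1 f2 : QmodZ) (g1 g2 : rat) (m : int) :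
  wave R f1 g1 m * ((wave R f2 g2 m)^*)%C =
  phase ((repr f1 - repr f2) * m%:~R + (g1 - g2)).
Proof.
rewrite /wave -!/(phase _) phase_conj -phaseD; congr phase; ring.
Qed.

Lemma wave_in_space (f : QmodZ) (g : rat) : wave_space R (wave R f g).
Proof.
exists 1%N, (fun=> 1), (fun=> wave R f g); split; first by exists f, g.
by rewrite big_ord1 scale1r.
Qed.

Lemma periodic_dvdn (u : int -> C) (n k : nat) :
  (n %| k)%N -> periodic u n%:Z -> periodic u k%:Z.
Proof.
case/dvdnP=> q -> un m.
by rewrite PoszM -[q%:Z]natz mulr_natl periodicn.
Qed.

(** The product of the two waves is constant when f1 = f2; otherwise it is a
    geometric progression of ratio e(f1 - f2) <> 1 that repeats after L steps,
    since both factors do. *)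
Lemma mean_wave_mul_conj (f1 f2 : QmodZ) (g1 g2 : rat) (L : nat) :
  (0 < L)%N -> periodic (wave R f1 g1) L%:Z -> periodic (wave R f2 g2) L%:Z ->
  L%:R^-1 * \sum_(1 <= m < L.+1) wave R f1 g1 m%:Z * ((wave R f2 g2 m%:Z)^*)%C =
  phase (g1 - g2) * (f1 == f2)%:R.
Proof.
move=> L_gt0 per1 per2.
pose t (m : int) := phase ((repr f1 - repr f2) * m%:~R + (g1 - g2)).
have tL : periodic t L%:Z.
  by move=> m; rewrite /t -!wave_mul_conj; congr (_ * conjc _);
    [exact: per1 | exact: per2].
rewrite (eq_bigr (fun m : nat => t m%:Z)) => [|m _]; last exact: wave_mul_conj.
have [f_eq|f_neq] := eqVneq f1 f2.
  rewrite (eq_bigr (fun=> phase (g1 - g2))) => [|m _]; last first.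
    by rewrite /t f_eq subrr mul0r add0r.
  rewrite sumr_const_nat subn1 /= mulr1 -[X in _ * X]mulr_natl mulKf //.
  by rewrite pnatr_eq0 -lt0n.
have ratio_neq1 : phase (repr f1 - repr f2) != 1.
  apply: contraNneq f_neq => /phase_eq1.
  by rewrite -eq_QmodZ !reprK.
rewrite mulr0 (sum_periodic_geometric _ _ _ ratio_neq1 tL) ?mulr0 // => m.
rewrite /t -phaseD; move: (_ - _) (_ - _) => x g; congr phase.
by rewrite intrD; ring.
Qed.

Lemma period_inner_wave (f1 f2 : QmodZ) (g1 g2 : rat) :
  period_inner (wave R f1 g1) (wave R f2 g2) = phase (g1 - g2) * (f1 == f2)%:R.
Proof.
rewrite /period_inner.
have [n1_gt0 per1 _] := fundamental_periodP (wave_in_space f1 g1).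
have [n2_gt0 per2 _] := fundamental_periodP (wave_in_space f2 g2).
(* as variables, the two periods cannot be unfolded during unification *)
move: (fundamental_period _) (fundamental_period _) n1_gt0 n2_gt0 per1 per2.
move=> n1 n2 n1_gt0 n2_gt0 per1 per2; apply: mean_wave_mul_conj.
- by rewrite lcmn_gt0 n1_gt0.
- exact: periodic_dvdn (dvdn_lcml _ _) per1.
- exact: periodic_dvdn (dvdn_lcmr _ _) per2.
Qed.

End Orthogonality.

Theorem theorem9p3 (R : realType) :
  (forall (f1 f2 : QmodZ) (g1 g2 : rat),
     period_inner (wave R f1 g1) (wave R f2 g2) =
       cexp (2 * pi%:C * 'i%C * ratr (g1 - g2)) * (f1 == f2)%:R) /\
  orthonormal_system (wave_space R) (@period_inner R) (wave_basis R).
Proof.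
split; first exact: period_inner_wave.
split=> [_ [f _ <-]|_ [f _ <-]|_ _ [f1 _ <-] [f2 _ <-] w_neq].
- exact: wave_in_space.
- by rewrite period_inner_wave subrr phase0 eqxx mulr1.
- rewrite period_inner_wave; case: eqVneq => [f_eq|_]; last by rewrite mulr0.
  by case: w_neq; rewrite f_eq.
Qed.
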